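(* Let $d\ge 2$ and $B>\pi\left(\tfrac{2}{3}\right)^{1/2}$. There is $n_0=n_0(B)$, independent of $d$, such that for all $n\ge n_0$, $$b_n\ge c_{n-1}e^{-B\sqrt{n-1}}\ge \mu^{n-1}e^{-B\sqrt{n-1}} .$$ In particular, $b_n^{1/n}\to\mu$ as $n\to\infty$, and so $\mu_{\mathrm{Bridge}}=\mu$.
   Context: An $n$-step self-avoiding walk (SAW) on $\mathbb{Z}^d$ is a sequence $\omega=(\omega(0),\dots,\omega(n))$ of pairwise distinct points of $\mathbb{Z}^d$ with $\|\omega(j)-\omega(j-1)\|_1=1$ for $j=1,\dots,n$. $c_n$ is the number of $n$-step SAWs with $\omega(0)=0$, and $\mu=\lim_{n\to\infty}c_n^{1/n}$ is the connective constant. Write $\omega_1(i)$ for the first coordinate of $\omega(i)$. An $n$-step bridge is an $n$-step SAW with $\omega_1(0)<\omega_1(i)\le\omega_1(n)$ for $i=1,\dots,n$. $b_n$ is the number of $n$-step bridges with $\omega(0)=0$ for $n\ge 1$, and $b_0=1$. Since $b_{n+m}\ge b_nb_m$, the limit $\mu_{\mathrm{Bridge}}=\lim_{n\to\infty}b_n^{1/n}=\sup_{n\ge1}b_n^{1/n}$ exists. *)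

(* Defs.v *)
From HB Require Import structures.
From mathcomp Require Import all_boot all_order all_algebra finmap.
From mathcomp Require Import all_classical all_reals all_analysis.
From mathcomp Require Import zify.
Set Implicit Arguments.
Unset Strict Implicit.
Unset Printing Implicit Defensive.
Import Order.TTheory GRing.Theory Num.Theory.
Import numFieldNormedType.Exports.
Local Open Scope classical_set_scope.
Local Open Scope ring_scope.

(* The sum norm; the library's norm on matrices is the maximum norm. *)
Definition l1norm (d : nat) (x : 'rV[int]_d) : int := \sum_(k < d) `|x ord0 k|.

(* The value for d = 0 is a dummy. *)
Definition first_coord (d : nat) : 'rV[int]_d -> int :=
  match d with
  | 0 => fun _ => 0
  | _.+1 => fun x => x ord0 ord0
  end.

(* [lift ord0 j] and [widen_ord _ j] are the indices j + 1 and j in 'I_n.+1. *)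
Definition is_saw (d n : nat) (w : {ffun 'I_n.+1 -> 'rV[int]_d}) : Prop :=
  injective w /\
  forall j : 'I_n, l1norm (w (lift ord0 j) - w (widen_ord (leqnSn n) j)) = 1.

Definition is_bridge (d n : nat) (w : {ffun 'I_n.+1 -> 'rV[int]_d}) : Prop :=
  is_saw w /\
  forall i : 'I_n.+1, (0 < i)%N ->
    first_coord (w ord0) < first_coord (w i) <= first_coord (w ord_max).

Definition saws (d n : nat) : set {ffun 'I_n.+1 -> 'rV[int]_d} :=
  [set w | is_saw w /\ w ord0 = 0].

Definition bridges (d n : nat) : set {ffun 'I_n.+1 -> 'rV[int]_d} :=
  [set w | is_bridge w /\ w ord0 = 0].

Arguments saws : clear implicits.
Arguments bridges : clear implicits.

Lemma saw_coord_le (d n : nat) (w : {ffun 'I_n.+1 -> 'rV[int]_d}) :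
  saws d n w -> forall (i : 'I_n.+1) (k : 'I_d), `|w i ord0 k| <= (i : nat)%:Z.
Proof.
move=> [[_ hstep] h0] [m hm] k /=.
elim: m hm => [|m IH] hm.
  by rewrite (_ : Ordinal hm = ord0) ?h0 ?mxE ?normr0//; apply: val_inj.
have hm' : (m < n)%N by [].
have := hstep (Ordinal hm').
rewrite (_ : lift ord0 _ = Ordinal hm); last exact: val_inj.
rewrite (_ : widen_ord _ _ = Ordinal (ltnW hm)); last exact: val_inj.
rewrite /l1norm (bigD1 k)//= !mxE => hs.
have h1 : `|w (Ordinal hm) ord0 k - w (Ordinal (ltnW hm)) ord0 k| <= 1.
  by rewrite -hs lerDl sumr_ge0.
have := IH (ltnW hm).
by lia.
Qed.

(* [fset_set] sends infinite sets to the empty one; the next two lemmas show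
   that this case does not occur in the counts below. *)
Lemma finite_saws (d n : nat) : finite_set (saws d n).
Proof.
pose f (g : {ffun 'I_n.+1 -> {ffun 'I_d -> 'I_(n + n).+1}}) :
    {ffun 'I_n.+1 -> 'rV[int]_d} :=
  [ffun i => \row_k ((g i k : nat)%:Z - n%:Z)].
apply: (@sub_finite_set _ _ (range f)); last exact: finite_image.
move=> w hw /=.
exists [ffun i => [ffun k => inord `|(w i ord0 k + n%:Z)%R|%N]] => //.
apply/ffunP => i; apply/rowP => k; rewrite !ffunE !mxE !ffunE.
have := saw_coord_le hw i k; have := ltn_ord i => hi hik.
have hn : (`|(w i ord0 k + n%:Z)%R|%N < (n + n).+1)%N by lia.
rewrite (inordK hn).
have h0 : 0 <= w i ord0 k + n%:Z by lia.
by rewrite gez0_abs // addrK.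
Qed.

Lemma finite_bridges (d n : nat) : finite_set (bridges d n).
Proof.
by apply: sub_finite_set (finite_saws d n) => w [[hw _] h0]; split.
Qed.

Definition saw_count (d n : nat) : nat := #|` fset_set (saws d n)|.

Definition bridge_count (d n : nat) : nat :=
  if n is 0 then 1%N else #|` fset_set (bridges d n)|.

Definition connective_constant (R : realType) (d : nat) : R :=
  lim ((fun n : nat => (saw_count d n)%:R `^ (n%:R)^-1 : R) @ \oo).

Definition bridge_constant (R : realType) (d : nat) : R :=
  lim ((fun n : nat => (bridge_count d n)%:R `^ (n%:R)^-1 : R) @ \oo).

(* Main.v *)
(* Following Hammersley and Welsh. Cutting a half-space walk at its last visit to
   its maximal hyperplane leaves a bridge of some span [a] and, after reflection,
   a half-space walk of height [b < a]; the spans of the successive bridges are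
   strictly decreasing, and the reflected pieces glue to a bridge. Weighting a
   bridge of span [s] by [x ^- s] turns this recursion directly into
   [h_n <= prod_(1 <= k <= n) (1 + x ^+ k) * x ^- n * b_n] for [0 < x <= 1], the
   product being the generating function of partitions into distinct parts.
   With [x = expR (- t)], Euler's odd-parts form of the product and
   [zeta(2) <= pi^2 / 6] bound it by [expR (pi^2 / (12 t))]; the best [t] gives
   [h_n <= b_n expR (pi sqrt (n / 3))]. Cutting an arbitrary walk at its last
   visit to its minimal hyperplane gives [c_n <= sum_m h_(n-m) h_(m+1)], whence
   [c_n <= (n + 1) b_(n+1) expR (pi sqrt (2 / 3) sqrt (n + 1))]. Fekete's lemma
   for [ln c_n] does the rest. *)
Require Import Defs.
From mathcomp Require Import all_boot all_order all_algebra finmap.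
From mathcomp Require Import all_classical all_reals all_analysis.
From mathcomp Require Import zify ring lra.
Set Implicit Arguments.
Unset Strict Implicit.
Unset Printing Implicit Defensive.
Import Order.TTheory GRing.Theory Num.Theory.
Import numFieldNormedType.Exports.
Local Open Scope classical_set_scope.
Local Open Scope ring_scope.

(** Each counting inequality is proved through a left inverse [g]: a cut is undone by gluing and a
    gluing by cutting, so no separate injectivity argument arises. *)
Lemma count_le_size_cover (S T : eqType) (P : pred S) (s : seq S) (t : seq T)
    (g : T -> S) :
  uniq s -> (forall x, x \in s -> P x -> exists2 y, y \in t & x = g y) ->
  (count P s <= size t)%N.
Proof.
move=> us h; rewrite -size_filter -(size_map g t).
apply: uniq_leq_size; first exact: filter_uniq.
move=> x; rewrite mem_filter => /andP[Px xs].
by have [y yt ->] := h x xs Px; apply: map_f.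
Qed.

Lemma has_split_last (T : Type) (P : pred T) (s : seq T) :
  has P s -> exists s1 x s2, [/\ s = s1 ++ x :: s2, P x & ~~ has P s2].
Proof.
elim: s => //= y s IH; case: (boolP (has P s)) => [/IH[s1 [x [s2 [-> Px h]]]]|h].
  by exists (y :: s1), x, s2.
by rewrite orbF => Py; exists [::], y, s.
Qed.

Lemma bigmaxn_attained (T : eqType) (F : T -> nat) (s : seq T) :
  s != [::] -> exists2 x, x \in s & F x = \max_(y <- s) F y.
Proof.
elim: s => // y [|z s] IH _; first by exists y; rewrite ?inE ?big_seq1.
have [x xs hx] := IH isT; rewrite big_cons -hx.
case: (leqP (F x) (F y)) => h.
  by exists y; rewrite ?mem_head.
by exists x => //; rewrite in_cons xs orbT.
Qed.

(** * Walks as lists of points *)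

Arguments first_coord : simpl never.

Section WalkLists.
Variable d : nat.
Let V := 'rV[int]_d.+1.
Implicit Types (x y : V) (p q u v : seq V).

Definition adjacent x y : bool := l1norm (y - x) == 1.

(* Lists of points omit the starting point [0] of the walk. *)
Definition walk p : bool := path adjacent 0 p && uniq (0 :: p).
Definition half_space p : bool := walk p && all (fun y => 0 < first_coord y) p.
Definition bridge p : bool :=
  half_space p && all (fun y => first_coord y <= first_coord (last 0 p)) p.
(** The absolute value only turns integers into naturals: heights are taken of half-space walks,
    whose listed first coordinates are positive. The empty walk has height 0. *)
Definition height p : nat := \max_(y <- p) `|first_coord y|%N.

(** * Functions on indices versus lists of points *)

Definition points (n : nat) (w : {ffun 'I_n.+1 -> V}) : seq V :=
  [seq w (lift ord0 i) | i <- enum 'I_n].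

Definition walks (n : nat) : seq (seq V) :=
  [seq points w | w <- fset_set (saws d.+1 n)].

(** Restoring the starting point aligns list positions with indices; injectivity of [w] then reads
    as [uniq] and the step condition as [path]. *)
Lemma nth_points n (w : {ffun 'I_n.+1 -> V}) (i : 'I_n.+1) :
  nth 0 (w ord0 :: points w) i = w i.
Proof.
case: i => [[|i] hi] /=; first by congr (w _); apply: val_inj.
have hi' : (i < n)%N by [].
rewrite (nth_map (Ordinal hi')) ?size_enum_ord //.
by congr (w _); apply: val_inj; rewrite /= nth_enum_ord.
Qed.

Lemma walk_points n (w : {ffun 'I_n.+1 -> V}) :
  w ord0 = 0 -> is_saw w <-> walk (points w).
Proof.
move=> w0; have sz : size (points w) = n by rewrite size_map size_enum_ord.
have N := nth_points w; rewrite w0 in N.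
have P : path adjacent 0 (points w) <->
    (forall j : 'I_n, l1norm (w (lift ord0 j) - w (widen_ord (leqnSn n) j)) = 1).
  split.
    move=> /(pathP 0); rewrite sz => h j; have := h j (ltn_ord j).
    by rewrite -(N (lift ord0 j)) -(N (widen_ord (leqnSn n) j)) /= => /eqP.
  move=> h; apply/(pathP 0); rewrite sz => i hi; apply/eqP.
  rewrite -(h (Ordinal hi)).
  by rewrite -(N (lift ord0 _)) -(N (widen_ord (leqnSn n) _)).
rewrite /walk; split.
  move=> [inj /P ->]; apply/(uniqP 0) => i j.
  rewrite !inE /= sz => hi hj.
  by rewrite (N (Ordinal hi)) (N (Ordinal hj)) => /inj[].
move=> /andP[/P hP /(uniqP 0) hU]; split=> // i j.
rewrite -(N i) -(N j) => /hU; rewrite !inE /= sz => /(_ (ltn_ord _) (ltn_ord _)).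
exact: val_inj.
Qed.

Lemma mem_walks n p : (p \in walks n) = (size p == n) && walk p.
Proof.
apply/mapP/andP => [[w]|[/eqP sz wp]].
  rewrite in_fset_set; last exact: finite_saws.
  rewrite inE => -[sw w0] ->; rewrite size_map size_enum_ord eqxx; split=> //.
  exact/(walk_points w0).
pose w : {ffun 'I_n.+1 -> V} := [ffun i : 'I_n.+1 => nth 0 (0 :: p) i].
have w0 : w ord0 = 0 by rewrite ffunE.
have pE : p = points w.
  apply: (@eq_from_nth _ 0); first by rewrite size_map size_enum_ord.
  rewrite sz => i hi.
  have := nth_points w (lift ord0 (Ordinal hi)); rewrite w0 /= => ->.
  by rewrite ffunE.
exists w => //; rewrite in_fset_set; last exact: finite_saws.
by rewrite inE; split=> //; apply/(walk_points w0); rewrite -pE.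
Qed.

Lemma points_inj n : {in saws d.+1 n &, injective (@points n)}.
Proof.
move=> w w'; rewrite !inE => -[_ w0] [_ w'0] e.
by apply/ffunP => i; rewrite -nth_points -(nth_points w') w0 w'0 e.
Qed.

Lemma uniq_walks n : uniq (walks n).
Proof.
rewrite map_inj_in_uniq ?fset_uniq // => w w'.
by rewrite !in_fset_set; first exact: points_inj; exact: finite_saws.
Qed.

Lemma size_walks n : size (walks n) = saw_count d.+1 n.
Proof. by rewrite size_map. Qed.

Lemma is_bridge_points n (w : {ffun 'I_n.+1 -> V}) :
  w ord0 = 0 -> is_bridge w <-> bridge (points w).
Proof.
move=> w0; have sz : size (points w) = n by rewrite size_map size_enum_ord.
have N := nth_points w; rewrite w0 in N.
have L : last 0 (points w) = w ord_max by rewrite (last_nth 0) sz -N.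
have f0 : first_coord (0 : V) = 0 by rewrite /first_coord mxE.
rewrite /bridge /half_space -andbA; split.
  move=> [/(walk_points w0) -> h] /=.
  apply/andP; split; apply/allP => y /(nthP 0)[i]; rewrite sz => hi <-;
    have := h (lift ord0 (Ordinal hi)) isT;
    rewrite -(N (lift ord0 _)) w0 f0 ?L;
    by case/andP.
move=> /and3P[/(walk_points w0) sw /allP h1 /allP h2]; split=> // i i0.
have yi : w i \in points w.
  rewrite -N; case: i i0 => [[|i] hi] //= _; apply: mem_nth.
  by rewrite sz.
by rewrite w0 f0 h1 //= -L h2.
Qed.

Lemma count_bridge n : count bridge (walks n) = bridge_count d.+1 n.
Proof.
(* The convention [b_0 = 1] agrees with the list side: the empty list is the only member of
   [walks 0] and is vacuously a [bridge]. *)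
case: n => [|n].
  have h : walks 0 =i [:: [::]].
    move=> p; rewrite mem_walks inE; case: p => //=.
  have := uniq_perm (uniq_walks 0) _ h => /(_ isT).
  by move=> /permP ->.
rewrite /bridge_count -size_filter.
rewrite -(size_map (@points n.+1) (fset_set (bridges _ _))).
apply: perm_size; apply: uniq_perm.
- exact/filter_uniq/uniq_walks.
- rewrite map_inj_in_uniq ?fset_uniq // => w w'.
  rewrite !in_fset_set; try exact: finite_bridges.
  rewrite !inE => -[[sw _] w0] [[sw' _] w'0]; apply: points_inj; rewrite inE;
  by split.
move=> p; rewrite mem_filter.
apply/andP/mapP => [[bp /mapP[w]]|[w]].
  rewrite in_fset_set; last exact: finite_saws.
  rewrite inE => -[sw w0] e; exists w => //.
  rewrite in_fset_set; last exact: finite_bridges.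
  by rewrite inE; split=> //; apply/(is_bridge_points w0); rewrite -e.
rewrite in_fset_set; last exact: finite_bridges.
rewrite inE => -[bw w0] ->; split; first exact/(is_bridge_points w0).
apply/mapP; exists w => //.
rewrite in_fset_set; last exact: finite_saws.
by rewrite inE; split=> //; case: bw.
Qed.

(** * Translation, reflection and concatenation *)

Lemma first_coordD x y : first_coord (x + y) = first_coord x + first_coord y.
Proof. by rewrite /first_coord mxE. Qed.

Lemma first_coordN x : first_coord (- x) = - first_coord x.
Proof. by rewrite /first_coord mxE. Qed.

Lemma first_coord0 : first_coord (0 : V) = 0.
Proof. by rewrite /first_coord mxE. Qed.

Lemma adjacentD z x y : adjacent (z + x) (z + y) = adjacent x y.
Proof. by rewrite /adjacent opprD addrACA subrr add0r. Qed.

Lemma adjacentC x y : adjacent x y = adjacent y x.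
Proof.
rewrite /adjacent -(opprB x y) /l1norm.
by under eq_bigr do rewrite mxE normrN.
Qed.

Lemma adjacent_first_coord x y :
  adjacent x y -> `|first_coord y - first_coord x| <= 1.
Proof.
move=> /eqP <-; rewrite /l1norm (bigD1 ord0) //= !mxE lerDl.
by apply: sumr_ge0.
Qed.

Definition mirror x : V :=
  \row_k (if k == ord0 then - x ord0 k else x ord0 k).

Lemma mirrorK : involutive mirror.
Proof. by move=> x; apply/rowP => k; rewrite !mxE; case: eqP; rewrite ?opprK. Qed.

Lemma mirror0 : mirror 0 = 0.
Proof. by apply/rowP => k; rewrite !mxE oppr0 if_same. Qed.

Lemma first_coord_mirror x : first_coord (mirror x) = - first_coord x.
Proof. by rewrite /first_coord mxE. Qed.

Lemma adjacent_mirror x y : adjacent (mirror x) (mirror y) = adjacent x y.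
Proof.
rewrite /adjacent /l1norm; congr (_ == _); apply: eq_bigr => k _.
by rewrite !mxE; case: eqP => // _; rewrite -opprD normrN.
Qed.

Lemma path_adjacent_map (h : V -> V) x p :
  (forall y z, adjacent (h y) (h z) = adjacent y z) ->
  path adjacent (h x) (map h p) = path adjacent x p.
Proof. by move=> hh; rewrite path_map; apply: eq_path => y z /=; exact: hh. Qed.

(** [h] stays abstract because tails are glued both by translation and by translation after
    [mirror]. *)
Lemma walk_cat (h : V -> V) u v :
  (forall y z, adjacent (h y) (h z) = adjacent y z) -> injective h ->
  h 0 = last 0 u ->
  walk (u ++ map h v) = [&& walk u, walk v & ~~ has (mem (0 :: u)) (map h v)].
Proof.
move=> hh hi h0; rewrite /walk cat_path -h0 path_adjacent_map //.
rewrite -cat_cons cat_uniq map_inj_uniq //.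
rewrite [uniq (0 :: v)]/=.
case: (boolP (has _ _)) => [|hn]; rewrite ?andbF ?andbT //=.
(* [h 0] is the end of [u], so a return of [v] to the origin would already be a meeting of the two
   pieces. *)
have -> : 0 \notin v.
  rewrite -(mem_map hi) h0; apply: contra hn => vin; apply/hasP.
  by exists (last 0 u) => //=; exact: mem_last.
by case: (path _ 0 u); case: (path _ 0 v); rewrite /= ?andbT ?andbF.
Qed.

Lemma walk_cat_translate u v :
  walk (u ++ [seq last 0 u + y | y <- v]) =
    [&& walk u, walk v & ~~ has (mem (0 :: u)) [seq last 0 u + y | y <- v]].
Proof.
apply: walk_cat; [exact: adjacentD | exact: addrI | exact: addr0].
Qed.

Lemma walk_first_coord_le p y : walk p -> y \in p -> first_coord y <= (size p)%:Z.
Proof.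
rewrite /walk => /andP[hp _].
suff : forall x, path adjacent x p -> y \in p ->
    first_coord y <= first_coord x + (size p)%:Z.
  by move=> /(_ _ hp); rewrite first_coord0 add0r.
elim: p {hp} => // z p IH x /= /andP[/adjacent_first_coord hz /IH{}IH].
rewrite inE => /orP[/eqP ->|/IH]; lia.
Qed.

Lemma half_space_last p :
  half_space p -> last 0 p = 0 \/ 0 < first_coord (last 0 p).
Proof.
case: p => [|y p]; first by left.
by move=> /andP[_ /allP h]; right; apply: h; rewrite /= mem_last.
Qed.

(** The hyperplane through the end of [u] separates the pieces: [u] stays weakly below it, the
    translate of [v] strictly above. *)
Lemma bridge_cat u v : bridge u -> bridge v ->
  bridge (u ++ [seq last 0 u + y | y <- v]).
Proof.
move=> /andP[/andP[wu /allP pu] /allP lu] bv.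
have /andP[hv /allP lv] := bv; have /andP[wv /allP pv] := hv.
have ge0u : 0 <= first_coord (last 0 u).
  have: last 0 u \in 0 :: u by exact: mem_last.
  by rewrite inE => /orP[/eqP ->|/pu/ltW //]; rewrite first_coord0.
have ge0v : 0 <= first_coord (last 0 v).
  have: last 0 v \in 0 :: v by exact: mem_last.
  by rewrite inE => /orP[/eqP ->|/pv/ltW //]; rewrite first_coord0.
have lE : last 0 (u ++ [seq last 0 u + y | y <- v]) = last 0 u + last 0 v.
  by rewrite last_cat -{1}(addr0 (last 0 u)) last_map.
rewrite /bridge /half_space walk_cat_translate.
rewrite wu wv !andTb -andbA lE first_coordD !all_cat !all_map.
apply/and3P; split.
- apply/hasPn => _ /mapP[y yv ->]; rewrite inE negb_or; apply/andP; split.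
    apply: contraTneq (pv y yv) => h.
    by have := congr1 (@first_coord d.+1) h; rewrite first_coordD first_coord0; lia.
  apply/negP => /lu; rewrite first_coordD.
  by have /= := pv y yv; lia.
- apply/andP; split; apply/allP => // y yv /=.
  by rewrite first_coordD ltr_wpDl // pv.
- apply/andP; split; apply/allP => y yv /=.
    by rewrite ler_wpDr // lu.
  by rewrite first_coordD lerD2l lv.
Qed.

(** * Submultiplicativity of walks, supermultiplicativity of bridges *)

Lemma saw_count_submultiplicative n m :
  (saw_count d.+1 (n + m) <= saw_count d.+1 n * saw_count d.+1 m)%N.
Proof.
rewrite -!size_walks -(size_allpairs pair) -(count_predT (walks (n + m))).
apply: (@count_le_size_cover _ _ _ _ _
  (fun uv => uv.1 ++ [seq last 0 uv.1 + y | y <- uv.2])).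
  exact: uniq_walks.
move=> p; rewrite mem_walks => /andP[/eqP sp wp] _.
pose u := take n p; pose v := [seq - last 0 u + y | y <- drop n p].
have pE : p = u ++ [seq last 0 u + y | y <- v].
  rewrite -map_comp map_id_in ?cat_take_drop // => y _ /=.
  by rewrite addNKr.
exists (u, v) => //; apply: allpairs_f; rewrite mem_walks.
  rewrite size_take sp; move: wp; rewrite pE walk_cat_translate.
  by move=> /and3P[-> _ _]; rewrite andbT; case: ltnP; lia.
rewrite size_map size_drop sp addKn eqxx; move: wp; rewrite pE walk_cat_translate.
by move=> /and3P[_ -> _].
Qed.

(** Concatenation is injective for fixed lengths: cutting after [n] steps and translating the tail
    back to the origin undoes it. *)
Lemma bridge_count_supermultiplicative n m :
  (bridge_count d.+1 n * bridge_count d.+1 m <= bridge_count d.+1 (n + m))%N.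
Proof.
rewrite -!count_bridge -!size_filter.
rewrite -(size_allpairs pair) -(count_predT (allpairs _ _ _)).
apply: (@count_le_size_cover _ _ _ _ _ (fun p =>
  (take n p, [seq - last 0 (take n p) + y | y <- drop n p]))).
  by rewrite allpairs_uniq ?filter_uniq ?uniq_walks // => -[? ?] [? ?].
move=> _ /allpairsP[[u v] /= [hu hv ->]] _.
move: hu hv; rewrite !mem_filter !mem_walks.
move=> /andP[bu /andP[/eqP su _]] /andP[bv /andP[/eqP sv _]].
exists (u ++ [seq last 0 u + y | y <- v]).
  have bw := bridge_cat bu bv; have /andP[/andP[ww _] _] := bw.
  by rewrite mem_filter mem_walks size_cat size_map su sv eqxx bw ww.
rewrite take_size_cat // drop_size_cat // -map_comp.
by rewrite map_id_in // => y _ /=; rewrite addKr.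
Qed.

Definition e1 : V := delta_mx ord0 ord0.

Lemma first_coord_e1 : first_coord e1 = 1.
Proof. by rewrite /first_coord mxE !eqxx. Qed.

Lemma adjacent_e1 x : adjacent x (x + e1).
Proof.
rewrite /adjacent addrAC subrr add0r /l1norm (bigD1 ord0) //= mxE !eqxx.
by rewrite big1 ?addr0 ?normr1 // => i i0; rewrite mxE (negbTE i0) andbF.
Qed.

Lemma bridge_e1 : bridge [:: e1].
Proof.
rewrite /bridge /half_space /walk /= first_coord_e1 !andbT.
have := adjacent_e1 0; rewrite add0r => -> /=; rewrite inE.
by apply/eqP => /(congr1 (@first_coord d.+1)); rewrite first_coord_e1 first_coord0.
Qed.

Lemma bridge_count_gt0 n : (0 < bridge_count d.+1 n)%N.
Proof.
elim: n => // n IH; rewrite -(addn1 n).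
apply: (leq_trans _ (bridge_count_supermultiplicative n 1)).
rewrite muln_gt0 IH -count_bridge -has_count; apply/hasP.
exists [:: e1]; last exact: bridge_e1.
by rewrite mem_walks; have /andP[/andP[-> _] _] := bridge_e1.
Qed.

Lemma bridge_count_le_saw_count n : (bridge_count d.+1 n <= saw_count d.+1 n)%N.
Proof. by rewrite -count_bridge -size_walks count_size. Qed.

(** * Half-space walks by height, bridges by span *)

Definition half_space_walks n a : seq (seq V) :=
  [seq p <- walks n | half_space p && (height p == a)].
Definition bridges_of_span n a : seq (seq V) :=
  [seq p <- walks n | bridge p && (`|first_coord (last 0%R p)|%N == a)].

Lemma height_ge p y : y \in p -> (`|first_coord y| <= height p)%N.
Proof.
by move=> yp; apply: (bigmaxn_sup_seq y).
Qed.

Lemma height_lt_walk p n : (0 < n)%N -> half_space p ->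
  all (fun y => first_coord y < n%:Z) p -> (height p < n)%N.
Proof.
move=> n0 /andP[_ /allP p0] /allP pn.
have [->|pn0] := eqVneq p [::]; first by rewrite /height big_nil.
have [y yp hy] := bigmaxn_attained (fun y => `|first_coord y|%N) pn0.
by rewrite /height -hy; have /= := p0 y yp; have /= := pn y yp; lia.
Qed.

Lemma half_space_height_le p n : half_space p -> size p = n -> (height p <= n)%N.
Proof.
move=> hp sp; rewrite -ltnS; apply: height_lt_walk => //.
apply/allP => y yp; have /andP[wp _] := hp.
by have := walk_first_coord_le wp yp; rewrite sp; lia.
Qed.

Lemma bridge_span_le p n : bridge p -> size p = n ->
  (`|first_coord (last 0%R p)| <= n)%N.
Proof.
move=> /andP[hp _] sp.
have := mem_last 0 p; rewrite inE => /orP[/eqP ->|yp].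
  by rewrite first_coord0.
by apply: leq_trans (half_space_height_le hp sp); exact: height_ge.
Qed.

(* [u] ends at the last visit to the maximal hyperplane. *)
Lemma half_space_decomposition p :
  half_space p -> p != [::] ->
  exists u v, [/\ p = u ++ [seq last 0 u + mirror y | y <- v],
    bridge u, `|first_coord (last 0%R u)|%N = height p, half_space v &
    (height v < height p)%N].
Proof.
move=> hp pn0; have /andP[wp /allP pp] := hp.
have [y0 y0p hy0] := bigmaxn_attained (fun y => `|first_coord y|%N) pn0.
have /has_split_last[u [x [w [pE fx nw]]]] :
    has (fun y => `|first_coord y|%N == height p) p.
  by apply/hasP; exists y0 => //; apply/eqP.
pose v := [seq mirror (y - x) | y <- w].
have hK : [seq x + mirror y | y <- v] = w.
  rewrite -map_comp map_id_in // => y _ /=.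
  by rewrite mirrorK addrC subrK.
have pE' : p = rcons u x ++ [seq last 0 (rcons u x) + mirror y | y <- v].
  by rewrite last_rcons hK cat_rcons.
have fx0 : 0 < first_coord x by apply: pp; rewrite pE mem_cat mem_head orbT.
have le y : y \in p -> first_coord y <= first_coord x.
  move=> yp; have := height_ge yp; rewrite -(eqP fx).
  by have /= := pp y yp; lia.
(* The cut is at the last maximal point, so later points lie strictly below it; this puts the
   reflected remainder in the open half-space. *)
have lt y : y \in w -> first_coord y < first_coord x.
  move=> yw; have yp : y \in p by rewrite pE mem_cat inE yw !orbT.
  have := le y yp; have /= := pp y yp; have := hasPn nw y yw.
  by rewrite -(eqP fx); lia.
have := wp; rewrite {1}pE' walk_cat; last 3 first.
- by move=> y z; rewrite adjacentD adjacent_mirror.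
- by move=> y z /addrI; apply: (inv_inj mirrorK).
- by rewrite mirror0 addr0.
move=> /and3P[wu wv _].
have inp y : y \in rcons u x -> y \in p by rewrite pE -cat_rcons mem_cat => ->.
have hv : half_space v.
  rewrite /half_space wv; apply/allP => _ /mapP[y yw ->].
  by rewrite first_coord_mirror first_coordD first_coordN oppr_gt0 subr_lt0 lt.
exists (rcons u x), v; split=> //.
- rewrite /bridge /half_space wu /= last_rcons; apply/andP; split; apply/allP.
    by move=> y /inp/pp.
  by move=> y /inp/le.
- by rewrite last_rcons (eqP fx).
(* A reflected point has first coordinate that of [x] minus that of [y]; this is below the height
   because [y] has positive first coordinate. *)
apply: height_lt_walk => //; first by rewrite -(eqP fx) absz_gt0 gt_eqF.
apply/allP => _ /mapP[y yw ->].
rewrite first_coord_mirror first_coordD first_coordN -(eqP fx).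
rewrite gtz0_abs // opprB ltrBlDr ltrDl; apply: pp.
by rewrite pE mem_cat inE yw !orbT.
Qed.

(** Here [j] is the length of the first bridge, whose span is the height [a], and [b] is the height
    of the reflected remainder; gluing recovers the walk from the pair. *)
Lemma half_space_walks_le n a : (0 < a)%N ->
  (size (half_space_walks n a) <=
   \sum_(j < n.+1) \sum_(b < a)
      size (bridges_of_span j a) * size (half_space_walks (n - j) b))%N.
Proof.
move=> a0; rewrite size_filter.
pose t := [seq uv | j <- iota 0 n.+1, uv <-
  [seq uv | b <- iota 0 a, uv <-
     [seq (u, v) | u <- bridges_of_span j a, v <- half_space_walks (n - j) b]]].
have -> : (\sum_(j < n.+1) \sum_(b < a)
      size (bridges_of_span j a) * size (half_space_walks (n - j) b))%N = size t.
  rewrite size_allpairs_dep sumnE big_map -(big_mkord predT (fun j =>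
    \sum_(b < a) size (bridges_of_span j a) * size (half_space_walks (n - j) b))%N).
  rewrite /index_iota subn0; apply: eq_bigr => j _.
  rewrite size_allpairs_dep sumnE big_map -(big_mkord predT (fun b =>
    size (bridges_of_span j a) * size (half_space_walks (n - j) b))%N).
  rewrite /index_iota subn0; apply: eq_bigr => b _.
  by rewrite size_allpairs.
apply: (@count_le_size_cover _ _ _ _ _
  (fun uv => uv.1 ++ [seq last 0 uv.1 + mirror y | y <- uv.2])).
  exact: uniq_walks.
move=> p; rewrite mem_walks => /andP[/eqP sp wp] /andP[hp /eqP ha].
have pn0 : p != [::].
  by apply: contraTneq a0 => p0; rewrite -ha p0 /height big_nil.
have [u [v [pE bu fu hv hvlt]]] := half_space_decomposition hp pn0.
have sE : (size u + size v)%N = n by rewrite -sp pE size_cat size_map.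
have /andP[/andP[wu _] _] := bu; have /andP[wv _] := hv.
exists (u, v) => //.
apply/allpairsPdep; exists (size u), (u, v); split=> //.
  by rewrite mem_iota; lia.
apply/allpairsPdep; exists (height v), (u, v); split=> //.
  by rewrite mem_iota -ha; lia.
apply: allpairs_f; rewrite mem_filter mem_walks.
  by rewrite bu fu ha wu !eqxx.
by rewrite hv wv -sE addKn !eqxx.
Qed.

(** The length [j] need not be recorded: with the span [a] fixed, the first factor of a glued bridge
    consists exactly of its points with first coordinate at most [a]. So even the pairs for all [j]
    together map injectively. *)
Lemma bridges_of_span_cat n a s :
  (\sum_(j < n.+1) size (bridges_of_span j a) * size (bridges_of_span (n - j) s)
   <= size (bridges_of_span n (a + s)))%N.
Proof.
pose t := [seq uv | j <- iota 0 n.+1, uv <-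
     [seq (u, v) | u <- bridges_of_span j a, v <- bridges_of_span (n - j) s]].
have -> : (\sum_(j < n.+1)
      size (bridges_of_span j a) * size (bridges_of_span (n - j) s))%N = size t.
  rewrite size_allpairs_dep sumnE big_map -(big_mkord predT (fun j =>
    size (bridges_of_span j a) * size (bridges_of_span (n - j) s))%N).
  rewrite /index_iota subn0; apply: eq_bigr => j _.
  by rewrite size_allpairs.
rewrite -(count_predT t).
pose cut (p : seq V) := [seq y <- p | first_coord y <= a%:Z].
apply: (@count_le_size_cover _ _ _ _ _ (fun p => (cut p,
  [seq - last 0 (cut p) + y | y <- p & ~~ (first_coord y <= a%:Z)]))).
  apply: allpairs_uniq_dep; first exact: iota_uniq.
    move=> j _; rewrite allpairs_uniq ?filter_uniq ?uniq_walks //.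
    by move=> [? ?] [? ?].
  (* [j] is the size of [u], so different [j] contribute different pairs. *)
  move=> _ _ /allpairsPdep[j [uv [_ h ->]]] /allpairsPdep[j' [uv' [_ h' ->]]] /=.
  move=> e; move: h'; rewrite -{}e.
  case/allpairsP: h => -[u v] /= [hu _ ->] /allpairsP[[u' v'] /= [hu' _ [e _]]].
  move: hu hu'; rewrite -e !mem_filter !mem_walks.
  by move=> /and3P[_ /eqP <- _] /and3P[_ /eqP <- _].
move=> _ /allpairsPdep[j [_ [hj /allpairsP[[u v] /= [hu hv ->]] ->]]] _.
move: hu hv; rewrite !mem_filter !mem_walks.
move=> /andP[/andP[bu /eqP fu] /andP[/eqP su _]].
move=> /andP[/andP[bv /eqP fv] /andP[/eqP sv _]].
have bw := bridge_cat bu bv; have /andP[/andP[ww _] _] := bw.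
have /andP[/andP[_ /allP pu] /allP lu] := bu.
have /andP[/andP[_ /allP pv] _] := bv.
have ge0 q : bridge q -> 0 <= first_coord (last 0 q).
  by move=> /andP[/half_space_last[->|/ltW //] _]; rewrite first_coord0.
have fu' : first_coord (last 0 u) = a by rewrite -fu; have := ge0 u bu; lia.
have fv' : first_coord (last 0 v) = s by rewrite -fv; have := ge0 v bv; lia.
have cutE : cut (u ++ [seq last 0 u + y | y <- v]) = u.
  rewrite /cut filter_cat (_ : seq.filter _ u = u); last first.
    by apply/all_filterP/allP => y yu; rewrite -fu' lu.
  rewrite (_ : seq.filter _ _ = [::]) ?cats0 //.
  apply/eqP; rewrite -(negbK (_ == _)) -has_filter; apply/hasPn => _ /mapP[y yv ->].
  by rewrite first_coordD fu' -ltNge ltrDl pv.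
exists (u ++ [seq last 0 u + y | y <- v]).
  rewrite mem_filter mem_walks size_cat size_map su sv ww bw.
  rewrite last_cat -[X in last X (map _ _)]addr0 last_map first_coordD fu' fv'.
  by move: hj; rewrite mem_iota; lia.
rewrite cutE filter_cat (_ : seq.filter _ u = [::]); last first.
  apply/eqP; rewrite -(negbK (_ == _)) -has_filter; apply/hasPn => y yu.
  by rewrite negbK -fu' lu.
rewrite cat0s (_ : seq.filter _ _ = [seq last 0 u + y | y <- v]); last first.
  apply/all_filterP/allP => _ /mapP[y yv ->].
  by rewrite first_coordD fu' -ltNge ltrDl pv.
by rewrite -map_comp map_id_in // => y _ /=; rewrite addKr.
Qed.

Lemma size_bridges_of_span_eq0 n s : (n < s)%N -> size (bridges_of_span n s) = 0%N.
Proof.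
move=> ns; apply/eqP; rewrite size_eq0 -(negbK (_ == _)) -has_filter.
apply/hasPn => p; rewrite mem_walks => /andP[/eqP sp wp].
apply/negP => /andP[bp /eqP fp].
by have := bridge_span_le bp sp; lia.
Qed.

Lemma half_space_walks_height0 n :
  (size (half_space_walks n 0) <= size (bridges_of_span n 0))%N.
Proof.
apply: uniq_leq_size; first exact/filter_uniq/uniq_walks.
move=> p; rewrite !mem_filter => /andP[/andP[hp /eqP h0] ->].
rewrite andbT.
have [->|pn0] := eqVneq p [::]; first by rewrite /= first_coord0.
(* A nonempty walk of height 0 would leave a remainder of height below 0. *)
have [u [v []]] := half_space_decomposition hp pn0.
by rewrite h0.
Qed.

(** A bridge has a single span, so it is counted at most once. *)
Lemma sum_bridges_of_span_le n N :
  (\sum_(s < N) size (bridges_of_span n s) <= bridge_count d.+1 n)%N.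
Proof.
rewrite -count_bridge -sum1_count [leqRHS]big_mkcond /=.
under eq_bigr do rewrite size_filter -sum1_count big_mkcond /=.
rewrite exchange_big /=; apply: leq_sum => p _.
case: (bridge p) => /=; last by rewrite big1.
rewrite -big_mkcond /= sum1_card.
apply/card_le1_eqP => i j; rewrite !unfold_in => /eqnP hi /eqnP hj.
by apply: val_inj; rewrite /= -hi -hj.
Qed.

Lemma count_half_space_le n :
  (count half_space (walks n) <= \sum_(a < n.+1) size (half_space_walks n a))%N.
Proof.
under eq_bigr do rewrite size_filter -sum1_count big_mkcond /=.
rewrite -sum1_count big_mkcond exchange_big /= big_seq [leqRHS]big_seq.
apply: leq_sum => p; rewrite mem_walks => /andP[/eqP sp _].
case: (boolP (half_space p)) => //= hp.
have h : (height p < n.+1)%N by rewrite ltnS half_space_height_le.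
by rewrite (bigD1 (Ordinal h)) //= eqxx.
Qed.

(* Cut at the last visit to the minimal hyperplane; the reversed first part is
   prefixed by the step [e1]. *)
Lemma saw_count_le_half_space n :
  (saw_count d.+1 n <= \sum_(m < n.+1)
     count half_space (walks (n - m)) * count half_space (walks m.+1))%N.
Proof.
rewrite -size_walks -(count_predT (walks n)).
pose hs m := seq.filter half_space (walks m).
pose t := [seq uv | m <- iota 0 n.+1, uv <-
     [seq (u, v) | u <- hs (n - m)%N, v <- hs m.+1]].
have -> : (\sum_(m < n.+1) count half_space (walks (n - m)) *
     count half_space (walks m.+1))%N = size t.
  rewrite size_allpairs_dep sumnE big_map -(big_mkord predT (fun m =>
     count half_space (walks (n - m)) * count half_space (walks m.+1))%N).
  rewrite /index_iota subn0; apply: eq_bigr => j _.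
  by rewrite size_allpairs !size_filter.
(* The second walk ends at [e1 - x], the image of the origin, which reveals the cut point [x].
   [behead] removes the starting point of the reassembled walk, since lists omit it. *)
apply: (@count_le_size_cover _ _ _ _ _ (fun uv =>
  let x := e1 - last 0 uv.2 in
  behead (rev [seq y - e1 + x | y <- uv.2] ++ [seq x + y | y <- uv.1]))).
  exact: uniq_walks.
move=> p; rewrite mem_walks => /andP[/eqP sp wp] _.
have [x0 hx0 min0] : exists2 x0, x0 \in 0 :: p &
    forall y, y \in 0 :: p -> first_coord x0 <= first_coord y.
  elim: (p) => [|y s [x xs hx]].
    by exists 0; rewrite ?inE // => y; rewrite inE => /eqP ->.
  have [xy|/ltW yx] := leP (first_coord x) (first_coord y).
    exists x; first by move: xs; rewrite !inE => /orP[->|->] //; rewrite !orbT.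
    move=> z; rewrite !inE => /or3P[/eqP ->|/eqP -> //|zs].
      by apply: hx; rewrite mem_head.
    by apply: hx; rewrite inE zs orbT.
  exists y; first by rewrite !inE eqxx orbT.
  move=> z; rewrite !inE => /or3P[/eqP ->|/eqP -> //|zs].
    by apply: (le_trans yx); apply: hx; rewrite mem_head.
  by apply: (le_trans yx); apply: hx; rewrite inE zs orbT.
have /has_split_last[q [x [r [pE /eqP fx nr]]]] :
    has (fun y => first_coord y == first_coord x0) (0 :: p).
  by apply/hasP; exists x0.
have lex y : y \in 0 :: p -> first_coord x <= first_coord y.
  by rewrite fx; exact: min0.
have ltx y : y \in r -> first_coord x < first_coord y.
  move=> yr; have := hasPn nr y yr; rewrite -fx.
  have := lex y; rewrite pE mem_cat inE yr !orbT => /(_ isT).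
  by rewrite lt_neqAle eq_sym => -> ->.
pose u := [seq - x + y | y <- r].
pose v := [seq - x + e1 + y | y <- x :: rev q].
have sE : (size q + size r = n)%N.
  by have := congr1 size pE; rewrite /= size_cat /= sp; lia.
have lastv : last 0 v = e1 - x.
  rewrite /v map_cons /= last_map.
  have -> : last x (rev q) = 0.
    by case: q pE {v lex sE} => [|z q] [<- _] //=; rewrite rev_cons last_rcons.
  by rewrite addr0 addrC.
have xE : e1 - last 0 v = x by rewrite lastv opprB addrC subrK.
have [pathq pathr] : path adjacent x r /\ path adjacent x (rev q).
  move: wp => /andP[hp _].
  case: q pE {u v lex lastv xE sE} => [|z q] [zE rE] /=.
    by move: hp; rewrite -zE rE.
  move: hp; rewrite zE rE cat_path /= => /and3P[hq ax hr]; split=> //.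
  have := rev_path adjacent z (rcons q x).
  rewrite last_rcons belast_rcons -(eq_path adjacentC) => ->.
  by rewrite rcons_path hq.
have := wp => /andP[_]; rewrite pE cat_uniq => /and3P[uq /hasPn nq /= /andP[xr ur]].
have xq : x \notin q by apply: nq; exact: mem_head.
have hu : half_space u.
  apply/andP; split; last first.
    apply/allP => _ /mapP[y yr ->].
    by rewrite first_coordD first_coordN addrC subr_gt0 ltx.
  rewrite /walk -[X in path _ X](addNr x) path_adjacent_map; last exact: adjacentD.
  rewrite pathq /= (map_inj_uniq (@addrI _ _)) ur andbT.
  by apply/mapP => -[y yr]; rewrite addrC => /esym/eqP; rewrite subr_eq0 => /eqP e;
    rewrite -e yr in xr.
have hv : half_space v.
  (* Points before the cut are only weakly above the minimal hyperplane; the shift by [e1] makes the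
     inequality strict. *)
  have pv : all (fun y => 0 < first_coord y) v.
    apply/allP => _ /mapP[y yr ->].
    rewrite !first_coordD first_coordN first_coord_e1 addrAC ltr_wpDl //.
    rewrite addrC subr_ge0 lex // pE mem_cat inE.
    by move: yr; rewrite inE mem_rev => /orP[->|->]; rewrite ?orbT.
  rewrite /half_space pv andbT /walk; apply/andP; split.
    have -> : v = e1 :: [seq - x + e1 + y | y <- rev q].
      by rewrite /v map_cons addrAC addNr add0r.
    rewrite [path _ _ _]/= -[X in adjacent _ X]add0r adjacent_e1 andTb.
    rewrite -[X in path _ X](_ : - x + e1 + x = e1); last first.
      by rewrite addrAC addNr add0r.
    by rewrite path_adjacent_map //; exact: adjacentD.
  rewrite cons_uniq (map_inj_uniq (@addrI _ _)) cons_uniq mem_rev xq rev_uniq uq.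
  by rewrite !andbT; apply/negP => v0; have := allP pv _ v0; rewrite first_coord0.
exists (u, v).
  apply/allpairsPdep; exists (size q), (u, v); split=> //.
    by rewrite mem_iota add0n ltnS -sE leq_addr.
  apply: allpairs_f; rewrite mem_filter mem_walks.
    by rewrite hu size_map -sE addKn eqxx; have /andP[-> _] := hu.
  by rewrite hv size_map /= size_rev eqxx; have /andP[-> _] := hv.
rewrite /= xE -[p]/(behead (0 :: p)) pE; congr (behead _).
rewrite -cat_rcons; congr (_ ++ _); last first.
  by rewrite -map_comp map_id_in // => y _ /=; rewrite addNKr.
have shift y : - x + e1 + y - e1 + x = y.
  by rewrite [- x + e1 + y]addrC addrA addrK subrK.
by rewrite -map_comp map_id_in ?rev_cons ?revK ?shift // => y _ /=; exact: shift.
Qed.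

End WalkLists.

(** * The weighted recursion *)

Section Weights.
Variable R : realType.
Variables (B H : nat -> nat -> nat) (x : R).
Hypothesis x_gt0 : 0 < x.
Hypothesis H0_le : forall n, (H n 0 <= B n 0)%N.
Hypothesis H_le : forall n a, (0 < a)%N ->
  (H n a <= \sum_(j < n.+1) \sum_(b < a) B j a * H (n - j) b)%N.
Hypothesis B_cat : forall n a s,
  (\sum_(j < n.+1) B j a * B (n - j) s <= B n (a + s))%N.
Hypothesis B_eq0 : forall n s, (n < s)%N -> B n s = 0%N.

(** Generating function of the partitions into distinct parts with largest part [a]; for [a = 0]
    only the empty partition remains. *)
Let weight (a : nat) : R :=
  if a is 0 then 1 else x ^+ a * \prod_(1 <= k < a) (1 + x ^+ k).

Lemma sum_weight a :
  \sum_(b < a.+1) weight b = \prod_(1 <= k < a.+1) (1 + x ^+ k).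
Proof.
elim: a => [|a IH]; first by rewrite big_ord1 big_nil.
by rewrite big_ord_recr /= IH [RHS]big_nat_recr //= mulrDr mulr1 [X in _ + X]mulrC.
Qed.

(** By [B_eq0] no span exceeds [n], so the truncation loses nothing. *)
Let genB n : R := \sum_(s < n.+1) (B n s)%:R / x ^+ s.

Lemma genB_extend n M : (n < M)%N -> genB n = \sum_(s < M) (B n s)%:R / x ^+ s.
Proof.
move=> nM; rewrite /genB -!(big_mkord predT (fun s => (B n s)%:R / x ^+ s)).
rewrite [RHS](big_cat_nat (n := n.+1)) //=.
rewrite [X in _ = _ + X]big1_seq ?addr0 // => s /andP[_].
by rewrite mem_index_iota => /andP[h _]; rewrite B_eq0 ?mul0r.
Qed.

Lemma sum_genB_shift n a :
  \sum_(s < n.+1) (B n (a + s))%:R / x ^+ s <= x ^+ a * genB n.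
Proof.
rewrite (@genB_extend n (a + n.+1)) ?leq_addl // mulr_sumr.
rewrite -(big_mkord predT (fun s => x ^+ a * ((B n s)%:R / x ^+ s))).
rewrite (big_cat_nat (n := a)) ?leq_addr //= ler_wpDl //.
  apply: sumr_ge0 => s _.
  by rewrite !mulr_ge0 ?invr_ge0 ?exprn_ge0 ?(ltW x_gt0).
rewrite -{2}[a]add0n big_addn addKn big_mkord ler_sum // => s _.
rewrite addnC exprD invfM.
rewrite mulrCA; rewrite [x ^+ a * _]mulrCA mulfV ?mulr1 //.
by rewrite expf_neq0 // gt_eqF.
Qed.

(** Strong induction on [a], for all [n] at once. The remainders of smaller height sum to the
    product by [sum_weight]; [B_cat] merges the first bridge with those counted by [genB], and the
    shift of span yields the leading power of [x] in [weight]. *)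
Lemma H_le_weight a n : (H n a)%:R <= weight a * genB n.
Proof.
elim/ltn_ind: a n => -[|a] IH n.
  rewrite mul1r /genB big_ord_recl expr0 divr1 ler_wpDr ?ler_nat //.
  by apply: sumr_ge0 => s _; rewrite mulr_ge0 ?invr_ge0 ?exprn_ge0 ?(ltW x_gt0).
have := H_le n (ltn0Sn a); rewrite -(ler_nat R) => /le_trans; apply.
rewrite natr_sum.
under eq_bigr do (rewrite natr_sum; under eq_bigr do rewrite natrM).
have step (j : 'I_n.+1) : \sum_(b < a.+1) (B j a.+1)%:R * (H (n - j) b)%:R <=
    (\sum_(b < a.+1) weight b) * ((B j a.+1)%:R * genB (n - j)).
  rewrite mulr_suml ler_sum // => b _.
  by rewrite mulrCA ler_wpM2l // IH.
apply: (le_trans (ler_sum _ (fun j _ => step j))).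
rewrite -mulr_sumr /= mulrAC sum_weight [leRHS]mulrC ler_wpM2l //.
  by apply: prodr_ge0 => k _; rewrite addr_ge0 ?exprn_ge0 ?(ltW x_gt0).
apply: le_trans (sum_genB_shift n a.+1).
have ext (j : 'I_n.+1) : (B j a.+1)%:R * genB (n - j) =
    \sum_(s < n.+1) (B j a.+1 * B (n - j) s)%:R / x ^+ s.
  rewrite (@genB_extend _ n.+1) ?ltnS ?leq_subr // mulr_sumr.
  by apply: eq_bigr => s _; rewrite natrM mulrA.
under eq_bigr do rewrite ext.
rewrite exchange_big /= ler_sum // => s _.
rewrite -mulr_suml -natr_sum ler_wpM2r ?ler_nat //.
  by rewrite invr_ge0 exprn_ge0 ?(ltW x_gt0).
exact: B_cat.
Qed.

Lemma sum_H_le n : x <= 1 ->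
  (\sum_(a < n.+1) H n a)%:R <=
  (\prod_(1 <= k < n.+1) (1 + x ^+ k)) * (\sum_(s < n.+1) B n s)%:R / x ^+ n.
Proof.
move=> x1; rewrite natr_sum.
apply: (@le_trans _ _ (\sum_(a < n.+1) weight a * genB n)).
  by apply: ler_sum => a _; exact: H_le_weight.
rewrite -mulr_suml sum_weight -mulrA ler_wpM2l //.
  by apply: prodr_ge0 => k _; rewrite addr_ge0 ?exprn_ge0 ?(ltW x_gt0).
(* Spans are at most [n] and [x <= 1], so every [x ^- s] is at most [x ^- n]. *)
rewrite natr_sum mulr_suml ler_sum // => s _; rewrite ler_wpM2l //.
rewrite lef_pV2 ?posrE ?exprn_gt0 // ler_wiXn2l ?(ltW x_gt0) //.
by rewrite -ltnS.
Qed.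

End Weights.

(** * Bounding the product *)

Section Analysis.
Variable R : realType.
Implicit Types (x y t : R).

(** * Elementary inequalities by monotonicity *)

Lemma ge_at0_of_derive_ge0 (f df : R -> R) (b : R) : 0 <= b ->
  (forall x, x \in `[0, b] -> is_derive x 1 f (df x)) ->
  (forall x, x \in `[0, b] -> 0 <= df x) -> f 0 <= f b.
Proof.
move=> b0 fd dp; rewrite -subr_ge0.
have fc : {within `[0, b], continuous f}.
  apply: derivable_within_continuous => x xb.
  by apply: (@ex_derive _ _ _ _ _ _ (df x)); exact: fd.
have fd' x : x \in `]0, b[ -> is_derive x 1 f (df x).
  by rewrite in_itv /= => /andP[x0 xb]; apply: fd; rewrite in_itv /= !ltW.
have [c cb ->] := MVT_segment b0 fd' fc.
by rewrite subr0 mulr_ge0 // dp.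
Qed.

Lemma sin_le x : 0 <= x -> sin x <= x.
Proof.
move=> x0; have := @ge_at0_of_derive_ge0 (fun y => y - sin y) (fun y => 1 - cos y) x x0.
rewrite sin0 subrr subr_ge0; apply => y _.
by rewrite subr_ge0 cos_le1.
Qed.

(** This is [x <= sinh x], used later to bound geometric series of odd powers. The derivative is
    nonnegative because [(expR y - 1) ^+ 2 >= 0]. *)
Lemma expR_sub_ge x : 0 <= x -> 2 * x <= expR x - expR (- x).
Proof.
move=> x0; have := @ge_at0_of_derive_ge0 (fun y => expR y - expR (- y) - 2 * y)
  (fun y => expR y + expR (- y) - 2) x x0.
rewrite oppr0 subrr mulr0 subr0 subr_ge0; apply => y _.
  apply: is_derive_eq; rewrite /GRing.scale /=; ring.
rewrite subr_ge0 expRN.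
have e0 := expR_gt0 y; rewrite -(ler_pM2l e0) [leRHS]mulrDr mulfV ?gt_eqF //.
by have := sqr_ge0 (expR y - 1); nra.
Qed.

Lemma is_derive_partial_log (J : nat) (y : R) :
  is_derive y 1 (fun z => \sum_(j < J) z ^+ j.+1 / j.+1%:R) (\sum_(j < J) y ^+ j).
Proof.
elim: J => [|J IH].
  rewrite big_ord0 (_ : (fun z => _) = cst 0); first exact: is_derive_cst.
  by apply/funext => z; rewrite big_ord0.
rewrite big_ord_recr (_ : (fun z => _) = (fun z =>
  \sum_(j < J) z ^+ j.+1 / j.+1%:R) \+ (fun z => z ^+ J.+1 / J.+1%:R)); last first.
  by apply/funext => z; rewrite big_ord_recr.
have -> : (fun z : R => z ^+ J.+1 / J.+1%:R) = J.+1%:R^-1 \*: (id ^+ J.+1 : R -> R).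
  by apply/funext => z; rewrite exprfctE /= mulrC.
apply: is_deriveD; apply: is_derive_eq.
by rewrite /GRing.scale /= mulr1 mulrA mulVf ?mul1r // pnatr_eq0.
Qed.

Lemma ln1B_ge x (J : nat) : 0 <= x < 1 ->
  - ln (1 - x) <= \sum_(j < J) x ^+ j.+1 / j.+1%:R + x ^+ J.+1 / (1 - x).
Proof.
move=> /andP[x0 x1].
(* The logarithm's derivative misses its partial geometric series by [y ^+ J / (1 - y)]; its value
   [C] at the right endpoint dominates this on the whole interval, so the linear term [C * y]
   absorbs the error. *)
pose C := x ^+ J / (1 - x).
have := @ge_at0_of_derive_ge0
  (fun y => \sum_(j < J) y ^+ j.+1 / j.+1%:R + C * y + ln (1 - y))
  (fun y => \sum_(j < J) y ^+ j + C - (1 - y)^-1) x x0.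
rewrite subr0 ln1 mulr0 !addr0 big1 => [|j _]; last by rewrite expr0n mul0r.
move=> h; rewrite -subr_ge0 opprK exprSr mulrAC; apply: h => y;
  rewrite in_itv /= => /andP[y0 yx];
  have y1 : 0 < 1 - y by rewrite subr_gt0 (le_lt_trans yx).
  have := is_derive_partial_log J y; have := is_derive1_ln y1 => dl dS.
  apply: is_derive_eq.
  by rewrite /GRing.scale /=; ring.
have -> : \sum_(j < J) y ^+ j = (1 - y)^-1 - y ^+ J / (1 - y).
  rewrite -{1}[(1 - y)^-1]mul1r -mulrBl -[1 - y ^+ J]opprB subrX1 -mulNr opprB.
  by rewrite mulrAC mulfV ?mul1r // gt_eqF.
rewrite (_ : _ - _ + C - _ = C - y ^+ J / (1 - y)); last by ring.
rewrite subr_ge0 /C.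
rewrite ler_pM ?exprn_ge0 ?invr_ge0 ?(ltW y1) ?lerXn2r ?nnegrE //.
by rewrite lef_pV2 ?posrE ?subr_gt0 ?lerD2l ?lerN2 // (le_lt_trans yx).
Qed.

(** * The sum of inverse squares *)

Lemma inv_sqr_sin_half x : sin (x / 2) != 0 -> cos (x / 2) != 0 ->
  (sin (x / 2)) ^- 2 + (cos (x / 2)) ^- 2 = 4 * (sin x) ^- 2.
Proof.
move=> s0 c0; have -> : sin x = sin (x / 2) * cos (x / 2) * 2.
  rewrite {1}(_ : x = (x / 2) *+ 2) ?sin_mulr2n; first by rewrite mulr_natr mulrC.
  by rewrite -mulr_natr divfK ?pnatr_eq0.
have := cos2Dsin2 (x / 2); move: s0 c0.
move: (sin _) (cos _) => s c s0 c0 sc.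
transitivity ((c ^+ 2 + s ^+ 2) / (s ^+ 2 * c ^+ 2)).
  by field; rewrite s0 c0.
by rewrite sc; field; rewrite s0 c0.
Qed.

(* Hofbauer's proof of Basel's identity: each angle [x] is replaced by the two
   angles [x / 2] and [pi / 2 - x / 2]. *)
Lemma sum_inv_sqr_sin n :
  \sum_(k < 2 ^ n) (sin (k.*2.+1%:R * pi / (2 ^ n.+2)%:R : R)) ^- 2 = 2 * 4 ^+ n.
Proof.
elim: n => [|n IH].
  rewrite big_ord1 expr0 mulr1 mul1r.
  have : cos ((pi / 4) *+ 2) = 0 :> R.
    by rewrite -mulr_natr (_ : pi / 4 * 2 = pi / 2 :> R) ?cos_pihalf //; field.
  rewrite cos_mulr2n => h; rewrite sin2cos2.
  rewrite (_ : 1 - _ = 2^-1) ?invrK //; lra.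
rewrite exprS mulrCA -IH mulr_sumr.
(* Term [k] is paired with term [2 ^ n.+1 - 1 - k], whose angle is [pi / 2 - x / 2]. *)
rewrite expnS mul2n -addnn big_split_ord /=.
rewrite [X in _ + X](reindex_inj rev_ord_inj) /= -big_split /=.
apply: eq_bigr => k _.
pose x : R := k.*2.+1%:R * pi / (2 ^ n.+2)%:R.
have p2 m : (2 ^ m)%:R != 0 :> R by rewrite pnatr_eq0 -lt0n expn_gt0.
have -> : k.*2.+1%:R * pi / (2 ^ n.+3)%:R = x / 2 :> R.
  by rewrite /x [(2 ^ n.+3)%N]expnS natrM; field; rewrite ?p2 ?pnatr_eq0.
have -> : (2 ^ n + (2 ^ n - k.+1)).*2.+1%:R * pi / (2 ^ n.+3)%:R = pi / 2 - x / 2 :> R.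
  have -> : (2 ^ n + (2 ^ n - k.+1)).*2.+1 = (2 ^ n.+2 - k.*2.+1)%N.
    by have := ltn_ord k; rewrite !expnS; lia.
  rewrite natrB; last by have := ltn_ord k; rewrite !expnS; lia.
  by rewrite /x [(2 ^ n.+3)%N]expnS natrM; field; rewrite ?p2 ?pnatr_eq0.
rewrite sinB sin_pihalf cos_pihalf mul1r mul0r subr0 -/x.
have x_gt0 : 0 < x by rewrite /x !mulr_gt0 ?pi_gt0 ?invr_gt0 ?ltr0n ?expn_gt0.
have x_lt : x < pi.
  rewrite /x ltr_pdivrMr ?ltr0n ?expn_gt0 // mulrC ltr_pM2l ?pi_gt0 // ltr_nat.
  by have := ltn_ord k; rewrite !expnS; lia.
apply: inv_sqr_sin_half; rewrite gt_eqF //.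
  by apply: sin_gt0_pihalf; lra.
by apply: cos_gt0_pihalf; lra.
Qed.

(** From [sin x <= x], each [x ^- 2] is at most [(sin x) ^- 2]. The exact sine sum over [2 ^ n >= n]
    angles then gives the bound after division by the scale factor [c]. *)
Lemma sum_inv_odd_sqr_le n : \sum_(k < n) (k.*2.+1%:R ^- 2 : R) <= pi ^+ 2 / 8.
Proof.
have le2n : (n <= 2 ^ n)%N by rewrite ltnW // ltn_expl.
have := sum_inv_sqr_sin n.
have pi0 : 0 < pi :> R := pi_gt0 R.
have p2 m : 0 < (2 ^ m)%:R :> R by rewrite ltr0n expn_gt0.
pose c : R := (2 ^ n.+2)%:R ^+ 2 / pi ^+ 2.
have le (k : 'I_(2 ^ n)) : c * k.*2.+1%:R ^- 2 <=
    (sin (k.*2.+1%:R * pi / (2 ^ n.+2)%:R : R)) ^- 2.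
  pose x : R := k.*2.+1%:R * pi / (2 ^ n.+2)%:R.
  have x_gt0 : 0 < x by rewrite /x !mulr_gt0 ?pi_gt0 ?invr_gt0 ?ltr0n ?expn_gt0.
  have x_lt : x < pi.
    rewrite /x ltr_pdivrMr // mulrC ltr_pM2l // ltr_nat.
    by have := ltn_ord k; rewrite !expnS; lia.
  have -> : c * k.*2.+1%:R ^- 2 = x ^- 2.
    rewrite /c /x; have : (pi : R) != 0 by rewrite gt_eqF.
    have : (k.*2.+1%:R : R) != 0 by rewrite pnatr_eq0.
    have : ((2 ^ n.+2)%:R : R) != 0 by rewrite gt_eqF.
    move: (pi : R) (k.*2.+1%:R : R) ((2 ^ n.+2)%:R : R) => p a b b0 a0 p0.
    by field; rewrite b0 a0 p0.
  rewrite -/x lef_pV2 ?posrE ?exprn_gt0 ?sin_gt0_pi ?x_gt0 //.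
  by rewrite lerXn2r ?nnegrE ?(ltW x_gt0) ?sin_le ?(ltW x_gt0) // sin_ge0_pi // !ltW.
move=> e.
have c0 : 0 < c by rewrite /c divr_gt0 ?exprn_gt0.
have : c * (\sum_(k < 2 ^ n) k.*2.+1%:R ^- 2) <= 2 * 4 ^+ n.
  by rewrite -e mulr_sumr; apply: ler_sum => k _; exact: le.
rewrite -ler_pdivlMl // => h.
apply: (@le_trans _ _ (\sum_(k < 2 ^ n) k.*2.+1%:R ^- 2)).
  rewrite -!(big_mkord predT (fun k => k.*2.+1%:R ^- 2)).
  rewrite [leRHS](big_cat_nat (n := n)) //= lerDl sumr_ge0 //.
apply: (le_trans h); rewrite /c natrX.
have -> : (4 : R) ^+ n = (2 ^+ n) ^+ 2 by rewrite exprAC -[in RHS]natrX.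
have -> : (2 : R) ^+ n.+2 = 4 * 2 ^+ n by rewrite !exprS mulrA -natrM.
have q0 : (2 : R) ^+ n != 0 by rewrite expf_neq0 // pnatr_eq0.
rewrite le_eqVlt; apply/orP; left; apply/eqP.
have : (pi : R) != 0 by rewrite gt_eqF.
move: (pi : R) ((2 : R) ^+ n) q0 => p q q0 p0.
by field; rewrite q0 p0.
Qed.

(** Even terms make up a quarter of the half-length sum, so three quarters of the sum are at most
    the odd sum, hence at most [pi ^+ 2 / 8]. *)
Lemma sum_inv_sqr_le n : \sum_(j < n) (j.+1%:R ^- 2 : R) <= pi ^+ 2 / 6.
Proof.
have split2 m : \sum_(j < m.*2) (j.+1%:R ^- 2 : R) =
    \sum_(k < m) (k.*2.+1%:R ^- 2 : R) + (\sum_(j < m) (j.+1%:R ^- 2 : R)) / 4.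
  elim: m => [|m IH]; first by rewrite !big_ord0 mul0r addr0.
  rewrite doubleS !big_ord_recr /= IH.
  have -> : (m.*2.+2%:R : R) ^- 2 = m.+1%:R ^- 2 / 4.
    by rewrite -doubleS -mul2n natrM exprMn invfM mulrC -[2%:R ^+ 2]natrX.
  by rewrite mulrDl; ring.
have mono : \sum_(j < n) (j.+1%:R ^- 2 : R) <= \sum_(j < n.*2) (j.+1%:R ^- 2 : R).
  rewrite -!(big_mkord predT (fun k => k.+1%:R ^- 2)).
  rewrite [leRHS](big_cat_nat (n := n)) -?addnn ?leq_addr //= lerDl sumr_ge0 //.
by have := sum_inv_odd_sqr_le n; rewrite split2 in mono; lra.
Qed.

(** * Euler's product identity and its logarithm *)

Lemma prod_1DX_mul n x :
  (\prod_(1 <= k < n.+1) (1 + x ^+ k)) * (\prod_(k < n) (1 - x ^+ k.*2.+1)) *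
    (\prod_(1 <= k < n.+1) (1 - x ^+ k)) = \prod_(1 <= k < n.*2.+1) (1 - x ^+ k).
Proof.
elim: n => [|n IH]; first by rewrite !big_nil big_ord0 !mul1r.
rewrite doubleS !(big_nat_recr _ _ _ (ltn0Sn _)) /= big_ord_recr /= -IH.
(* The factors [1 + x ^+ k] and [1 - x ^+ k] combine to the even factor [1 - x ^+ (2 k)]. *)
have -> : x ^+ n.*2.+2 = (x ^+ n.+1) ^+ 2 by rewrite -doubleS -muln2 exprM.
by ring.
Qed.

(** A finite form of Euler's identity: the defect from 1 is the product of the factors [1 - x ^+ k]
    with [n < k <= 2 n], all at most 1. *)
Lemma prod_1DX_le n x : 0 <= x < 1 ->
  (\prod_(1 <= k < n.+1) (1 + x ^+ k)) * (\prod_(k < n) (1 - x ^+ k.*2.+1)) <= 1.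
Proof.
move=> /andP[x0 x1].
have pos k : (0 < k)%N -> 0 < 1 - x ^+ k.
  by move=> k0; rewrite subr_gt0 exprn_ilt1 // -lt0n.
have D0 : 0 < \prod_(1 <= k < n.+1) (1 - x ^+ k).
  rewrite big_nat_cond prodr_gt0 // => k /andP[/andP[k0 _] _]; exact: pos.
rewrite -(ler_pM2r D0) mul1r prod_1DX_mul.
rewrite (big_cat_nat (n := n.+1)) //=; last by rewrite ltnS -addnn leq_addr.
rewrite ler_piMr ?(ltW D0) // big_nat_cond.
apply: prodr_ile1 => k /andP[/andP[k0 _] _].
have k1 : (0 < k)%N by apply: leq_trans k0.
by rewrite (ltW (pos k k1)) /= gerBl exprn_ge0.
Qed.

(** Expand each logarithm to order [J] and exchange the sums. The odd powers form a geometric series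
    below [1 / (2 sinh (t j)) <= 1 / (2 t j)]; the further [1 / j] from the logarithm leaves the
    inverse squares, hence [pi ^+ 2 / (12 t)]. *)
Lemma ln_prod_odd_ge n t : 0 < t ->
  - (pi ^+ 2 / (12 * t)) <= ln (\prod_(k < n) (1 - expR (- t) ^+ k.*2.+1)).
Proof.
move=> t0; set x := expR (- t).
have x0 : 0 < x by exact: expR_gt0.
have x1 : x < 1 by rewrite /x expR_lt1 oppr_lt0.
have pos k : (0 < k)%N -> 0 < 1 - x ^+ k.
  by move=> k0; rewrite subr_gt0 exprn_ilt1 ?(ltW x0) // -lt0n.
have lnE : ln (\prod_(k < n) (1 - x ^+ k.*2.+1)) =
    \sum_(k < n) ln (1 - x ^+ k.*2.+1).
  elim: n => [|n IH]; first by rewrite !big_ord0 ln1.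
  rewrite !big_ord_recr /= lnM ?IH ?posrE ?pos //.
  by rewrite prodr_gt0 // => k _; rewrite pos.
rewrite lnE lerNl -sumrN.
have geo (j : nat) : \sum_(k < n) (x ^+ k.*2.+1) ^+ j.+1 <= (2 * t * j.+1%:R)^-1.
  set y := x ^+ j.+1.
  have y0 : 0 < y by rewrite exprn_gt0.
  have y1 : y < 1 by rewrite exprn_ilt1 // ltW.
  have -> : \sum_(k < n) (x ^+ k.*2.+1) ^+ j.+1 = y * \sum_(k < n) (y ^+ 2) ^+ k.
    rewrite mulr_sumr; apply: eq_bigr => k _.
    by rewrite exprAC -/y exprS -mul2n exprM.
  have yE : y = expR (- (t * j.+1%:R)).
    by rewrite /y /x -expRM_natr mulNr.
  have := @expR_sub_ge (t * j.+1%:R); rewrite -yE.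
  have -> : expR (t * j.+1%:R) = y^-1 by rewrite yE expRN invrK.
  rewrite mulrA => /(_ (mulr_ge0 (ltW t0) (ler0n _ _))) h.
  have tj : 0 < 2 * t * j.+1%:R by rewrite !mulr_gt0.
  apply: (@le_trans _ _ (y^-1 - y)^-1); last first.
    by rewrite lef_pV2 ?posrE // (lt_le_trans tj).
  have yy : y^-1 - y = (1 - y ^+ 2) / y by field; rewrite gt_eqF.
  have y21 : 0 < 1 - y ^+ 2 by rewrite subr_gt0 exprn_ilt1 // ltW.
  rewrite yy invf_div ler_wpM2l ?(ltW y0) //.
  rewrite -[leRHS]mul1r ler_pdivlMr //.
  have := subrX1 (y ^+ 2) n; have : 0 <= (y ^+ 2) ^+ n by rewrite !exprn_ge0 ?ltW.
  move: (y ^+ 2) (\sum_(i < n) _) => z S; move: (z ^+ n) => w; nra.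
have bound J : \sum_(k < n) - ln (1 - x ^+ k.*2.+1) <=
    pi ^+ 2 / (12 * t) + (n%:R / (1 - x)) * x ^+ J.+1.
  (* The remainder is made uniform in [k] by [x ^+ k.*2.+1 <= x]. *)
  have tail (k : 'I_n) : - ln (1 - x ^+ k.*2.+1) <=
     \sum_(j < J) (x ^+ k.*2.+1) ^+ j.+1 / j.+1%:R + x ^+ J.+1 / (1 - x).
    have yb : 0 <= x ^+ k.*2.+1 < 1 by rewrite exprn_ge0 ?exprn_ilt1 ?(ltW x0).
    apply: (le_trans (ln1B_ge J yb)); rewrite lerD2l.
    have xk : x ^+ k.*2.+1 <= x by rewrite exprS ger_pMr // exprn_ile1 // ltW.
    rewrite ler_pM ?exprn_ge0 ?invr_ge0 ?(ltW (pos _ _)) ?(ltW x0) //.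
      by rewrite lerXn2r ?nnegrE ?exprn_ge0 ?(ltW x0).
    by rewrite lef_pV2 ?posrE ?pos ?subr_gt0 // lerD2l lerN2.
  apply: (le_trans (ler_sum _ (fun k _ => tail k))).
  rewrite big_split /= sumr_const card_ord.
  apply: lerD; last first.
    by rewrite -[leLHS]mulr_natl -mulrA [_^-1 * _]mulrC.
  rewrite exchange_big /=.
  apply: (@le_trans _ _ (\sum_(j < J) (2 * t)^-1 * j.+1%:R ^- 2)).
    apply: ler_sum => j _; rewrite -mulr_suml.
    rewrite expr2 [(_ * j.+1%:R)^-1]invfM mulrA -invfM.
    by rewrite ler_wpM2r ?invr_ge0 // geo.
  rewrite -mulr_sumr ler_pdivrMl ?mulr_gt0 //.
  apply: (le_trans (sum_inv_sqr_le J)).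
  rewrite le_eqVlt; apply/orP; left; apply/eqP.
  by move: (pi : R) => p; field; rewrite gt_eqF.
(* With [n] fixed, the accumulated remainder vanishes as [J] grows. *)
have cv : (pi ^+ 2 / (12 * t) + (n%:R / (1 - x)) * x ^+ J.+1 : R) @[J --> \oo]
     --> pi ^+ 2 / (12 * t) + (n%:R / (1 - x)) * 0.
  apply: cvgD; first exact: cvg_cst.
  apply: cvgM; first exact: cvg_cst.
  by rewrite (cvg_shiftS (fun J => x ^+ J)); apply: cvg_expr; rewrite gtr0_norm.
rewrite mulr0 addr0 in cv.
apply: (cvgr_to_ge cv); apply: nearW => J; exact: bound.
Qed.

Lemma prod_1DexpRN_le n t : 0 < t ->
  \prod_(1 <= k < n.+1) (1 + expR (- t) ^+ k) <= expR (pi ^+ 2 / (12 * t)).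
Proof.
move=> t0; set x := expR (- t).
have x0 : 0 < x by exact: expR_gt0.
have x1 : x < 1 by rewrite /x expR_lt1 oppr_lt0.
have O0 : 0 < \prod_(k < n) (1 - x ^+ k.*2.+1).
  by rewrite prodr_gt0 // => k _; rewrite subr_gt0 exprn_ilt1 ?(ltW x0).
have := @prod_1DX_le n x; rewrite (ltW x0) x1 => /(_ isT).
rewrite -ler_pdivlMr // mul1r => /le_trans; apply.
rewrite -[_^-1]lnK ?posrE ?invr_gt0 // ler_expR lnV ?posrE // lerNl.
exact: ln_prod_odd_ge.
Qed.

(* [t = pi / sqrt (12 n)] minimises [t n + pi^2 / (12 t)]. *)
Lemma prod_1DX_optimal (n : nat) :
  exists2 x : R, 0 < x <= 1 &
    \prod_(1 <= k < n.+1) (1 + x ^+ k) / x ^+ n <= expR (pi * Num.sqrt (n%:R / 3)).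
Proof.
case: (posnP n) => [->|n0].
  exists 1; first by rewrite ltr01 lexx.
  by rewrite big_nil expr0 divr1 mul0r sqrtr0 mulr0 expR0.
set s := Num.sqrt (n%:R / 3 : R).
have s0 : 0 < s by rewrite sqrtr_gt0 divr_gt0 ?ltr0n.
have ss : s ^+ 2 = n%:R / 3 by rewrite sqr_sqrtr // divr_ge0.
have p0 : 0 < pi :> R := pi_gt0 R.
pose t : R := pi / (6 * s).
have t0 : 0 < t by rewrite /t divr_gt0 ?mulr_gt0.
exists (expR (- t)); first by rewrite expR_gt0 expR_le1 oppr_le0 ltW.
apply: (@le_trans _ _ (expR (pi ^+ 2 / (12 * t)) / expR (- t) ^+ n)).
  by rewrite ler_wpM2r ?invr_ge0 ?exprn_ge0 ?expR_ge0 // prod_1DexpRN_le.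
rewrite -expRM_natr -expRN -expRD ler_expR mulNr opprK.
have -> : (n%:R : R) = 3 * s ^+ 2 by rewrite ss mulrC divfK ?pnatr_eq0.
(* At this [t] the terms [t n] and [pi ^+ 2 / (12 t)] both equal [pi * s / 2]. *)
rewrite le_eqVlt; apply/orP; left; apply/eqP; rewrite /t.
move: (pi : R) p0 => p p0; field.
by rewrite !gt_eqF.
Qed.

(** The limit is the infimum of [u n / n] over positive [n]. The bound [n L <= u n] is kept in the
    conclusion because it later gives [mu ^+ n <= c_n]. *)
Lemma fekete (u : nat -> R) :
  (forall n, 0 <= u n) -> (forall n m, u (n + m)%N <= u n + u m) ->
  exists2 L : R, (forall n, n%:R * L <= u n) & (u n / n%:R) @[n --> \oo] --> L.
Proof.
move=> u0 uD.
pose S := [set u n.+1 / n.+1%:R | n in [set: nat]].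
have S0 : has_inf S.
  split; first by exists (u 1%N / 1%:R), 0%N.
  by exists 0 => _ [n _ <-]; rewrite divr_ge0.
pose L := inf S.
have LB n : L <= u n.+1 / n.+1%:R by apply: inf_lbound; [case: S0 | exists n].
exists L.
  case=> [|n]; first by rewrite mul0r.
  by rewrite mulrC -ler_pdivlMr ?ltr0n.
apply/cvgrPdist_le => e e0.
have e20 : 0 < e / 2 by rewrite divr_gt0.
have [_ [m _ <-] mL] := inf_adherent e20 S0; rewrite -/L in mL.
have uM k n : u (k * n)%N <= k%:R * u n + u 0%N.
  elim: k => [|k IH]; first by rewrite mul0n mul0r add0r.
  rewrite mulSn (le_trans (uD _ _)) // -natr1 mulrDl mul1r; lra.
(* After division of [n] by [m.+1], the sum over all residues bounds the remainder term; [u 0%N]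
   covers a zero quotient. *)
pose C := u 0%N + \sum_(r < m.+1) u r.
have C0 : 0 <= C by rewrite addr_ge0 // sumr_ge0.
have key n : u n <= n%:R * (u m.+1 / m.+1%:R) + C.
  rewrite {1}(divn_eq n m.+1) (le_trans (uD _ _)) //.
  have hr : u (n %% m.+1)%N <= \sum_(r < m.+1) u r.
    have hr : (n %% m.+1 < m.+1)%N by rewrite ltn_mod.
    by rewrite (bigD1 (Ordinal hr)) //= lerDl sumr_ge0.
  have hq : (n %/ m.+1)%:R * u m.+1 <= n%:R * (u m.+1 / m.+1%:R).
    rewrite mulrA [leRHS]mulrAC ler_wpM2r // ler_pdivlMr ?ltr0n // -natrM ler_nat.
    exact: leq_trunc_div.
  by apply: (le_trans (lerD (uM _ _) hr)); rewrite -addrA lerD2r.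
near=> n.
have n0 : (0 < n)%N by near: n; exact: nbhs_infty_gt.
have n0' : 0 < n%:R :> R by rewrite ltr0n.
have nC : C / n%:R <= e / 2.
  rewrite ler_pdivrMr // mulrC -ler_pdivrMr //.
  near: n; exact: nbhs_infty_ger.
have lb : L <= u n / n%:R by rewrite -(prednK n0).
rewrite distrC ger0_norm ?subr_ge0 //.
have : u n / n%:R <= u m.+1 / m.+1%:R + C / n%:R.
  by rewrite ler_pdivrMr // mulrDl divfK ?gt_eqF // mulrC.
rewrite lerBlDl => /le_trans; apply; apply: (le_trans (lerD (ltW mL) nC)).
by rewrite -addrA -splitr.
Unshelve. all: by end_near. Qed.

End Analysis.

(** * Asymptotics *)

Section Asymptotics.
Variable R : realType.

Lemma count_half_space_bound d n :
  (count (@half_space d) (walks d n))%:R <=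
  (bridge_count d.+1 n)%:R * expR (pi * Num.sqrt (n%:R / 3)) :> R.
Proof.
have [x /andP[x0 x1] hx] := prod_1DX_optimal R n.
have := @sum_H_le R (fun m a => size (bridges_of_span d m a))
  (fun m a => size (half_space_walks d m a)) x x0
  (@half_space_walks_height0 d) (@half_space_walks_le d)
  (@bridges_of_span_cat d) (@size_bridges_of_span_eq0 d) n x1.
have := count_half_space_le d n; rewrite -(ler_nat R) => /le_trans h /h{h}.
move=> /le_trans; apply; rewrite mulrAC [leRHS]mulrC.
apply: ler_pM => //.
  rewrite divr_ge0 ?exprn_ge0 ?(ltW x0) ?prodr_ge0 // => k _.
  by rewrite addr_ge0 ?exprn_ge0 ?(ltW x0).
by rewrite ler_nat sum_bridges_of_span_le.
Qed.

(** Sharing the length between two half-space walks turns the constant [sqrt (1 / 3)] into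
    [sqrt (2 / 3)]. *)
Lemma sqrt_add_le (a b : R) : 0 <= a -> 0 <= b ->
  Num.sqrt a + Num.sqrt b <= Num.sqrt (2 * (a + b)).
Proof.
move=> a0 b0; rewrite -[leLHS]ger0_norm ?addr_ge0 ?sqrtr_ge0 // -sqrtr_sqr.
rewrite ler_wsqrtr //.
have := sqr_ge0 (Num.sqrt a - Num.sqrt b).
rewrite sqrrB sqrrD !sqr_sqrtr //; lra.
Qed.

(** The lengths [n - m] and [m.+1] add up to [n.+1], so each of the [n.+1] cuts has the same
    bound. *)
Lemma saw_count_bound d n :
  (saw_count d.+1 n)%:R <= n.+1%:R * (bridge_count d.+1 n.+1)%:R *
    expR (pi * Num.sqrt (2 / 3) * Num.sqrt n.+1%:R) :> R.
Proof.
have := saw_count_le_half_space d n; rewrite -(ler_nat R) => /le_trans; apply.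
rewrite natr_sum -mulrA mulr_natl -[X in _ *+ X](card_ord n.+1) -sumr_const.
apply: ler_sum => m _; rewrite natrM.
apply: (le_trans (ler_pM _ _ (count_half_space_bound d (n - m))
  (count_half_space_bound d m.+1))) => //.
rewrite mulrACA -natrM -expRD -mulrDr.
have mn : (m <= n)%N by rewrite -ltnS.
apply: ler_pM; rewrite ?expR_ge0 ?mulr_ge0 //.
  rewrite ler_nat (leq_trans (bridge_count_supermultiplicative _ _ _)) //.
  by rewrite addnS subnK.
rewrite ler_expR -mulrA ler_wpM2l ?pi_ge0 //.
apply: (le_trans (sqrt_add_le _ _)); rewrite ?divr_ge0 //.
rewrite -mulrDl -natrD addnS subnK // mulrCA mulrC sqrtrM ?divr_ge0 //.
Qed.

Lemma polynomial_correction_absorbed (beta B : R) : 0 <= beta -> beta < B ->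
  exists N : nat, forall n, (N <= n)%N ->
    n.+1%:R * expR (beta * Num.sqrt n.+1%:R) <= expR (B * Num.sqrt n%:R).
Proof.
move=> b0 bB; pose e := B - beta; have e0 : 0 < e by rewrite subr_gt0.
(* With [s] the root of [n], the polynomial factor is at most [2 * s ^+ 2] and the gap [e] supplies
   [expR (e * s) >= (e * s) ^+ 3 / 6]. The cube wins against the extra [expR beta] exactly when
   [s >= K]. *)
pose K : R := 12 * expR beta / e ^+ 3.
have K0 : 0 <= K by rewrite divr_ge0 ?mulr_ge0 ?expR_ge0 ?exprn_ge0 ?(ltW e0).
exists (Num.bound (K ^+ 2)).+1 => -[//|n] hn.
set s := Num.sqrt n.+1%:R.
have s0 : 0 <= s by exact: sqrtr_ge0.
have ss : s ^+ 2 = n.+1%:R by rewrite sqr_sqrtr.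
have sK : K <= s.
  rewrite -[K]ger0_norm // -sqrtr_sqr ler_wsqrtr // ltW //.
  apply: (lt_le_trans (archi_boundP (exprn_ge0 2 K0))).
  by rewrite ler_nat ltnW.
have s1 : Num.sqrt n.+2%:R <= s + 1.
  rewrite -[s + 1]ger0_norm ?addr_ge0 // -sqrtr_sqr ler_wsqrtr //.
  by rewrite sqrrD ss expr1n mulr1 -natr1 lerD2r lerDl mulrn_wge0.
have cube : e ^+ 3 * s ^+ 3 / 6 <= expR (e * s).
  have := @expR_ge1Dxn R (e * s) 2 (mulr_ge0 (ltW e0) s0).
  by rewrite exprMn; apply: le_trans; rewrite lerDr.
have n2 : n.+2%:R <= 2 * s ^+ 2 by rewrite ss -natrM ler_nat; lia.
have eB : expR (B * s) = expR (e * s) * expR (beta * s).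
  by rewrite -expRD -mulrDl subrK.
have eb : expR (beta * Num.sqrt n.+2%:R) <= expR beta * expR (beta * s).
  rewrite -expRD ler_expR (_ : beta + _ = beta * (s + 1)); last by ring.
  by rewrite ler_wpM2l.
apply: (le_trans (ler_pM _ _ n2 eb)); rewrite ?expR_ge0 //.
rewrite mulrA eB ler_wpM2r ?expR_ge0 // (le_trans _ cube) //.
move: sK; rewrite /K ler_pdivrMr ?exprn_gt0 // => sK.
have := ler_wpM2l (exprn_ge0 2 s0) sK.
by rewrite (_ : s ^+ 2 * (s * e ^+ 3) = e ^+ 3 * s ^+ 3); [lra | ring].
Qed.

(** [n0] precedes [d] because the threshold that absorbs the polynomial factor depends on [B]
    alone. *)
Lemma bridge_count_lower (B : R) : B > pi * Num.sqrt (2 / 3) ->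
  exists n0 : nat, forall d n, (n0 <= n)%N ->
    (saw_count d.+1 n.-1)%:R * expR (- B * Num.sqrt (n.-1)%:R) <=
      (bridge_count d.+1 n)%:R.
Proof.
move=> hB.
have b0 : 0 <= pi * Num.sqrt (2 / 3) :> R by rewrite mulr_ge0 ?pi_ge0 ?sqrtr_ge0.
have [N hN] := polynomial_correction_absorbed b0 hB.
exists N.+1 => d [//|n] /= Nn.
rewrite mulNr expRN ler_pdivrMr ?expR_gt0 //.
apply: (le_trans (saw_count_bound d n)).
by rewrite mulrAC mulrC ler_wpM2l // hN.
Qed.

(** * Convergence of the roots *)

Lemma saw_count_gt0 d n : (0 < saw_count d.+1 n)%N.
Proof. exact: leq_trans (bridge_count_gt0 d n) (bridge_count_le_saw_count d n). Qed.

(** It also holds at [n = 0], where [0^-1 = 0] makes both sides 1, so whole sequences can be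
    rewritten. *)
Lemma powR_inv_nat (c n : nat) : (0 < c)%N ->
  (c%:R : R) `^ n%:R^-1 = expR (ln c%:R / n%:R).
Proof. by move=> c0; rewrite /powR pnatr_eq0 gtn_eqF // mulrC. Qed.

(** Fekete's lemma for [ln c_n] supplies the convergence that gives the [lim] in
    [connective_constant] its meaning. *)
Lemma connective_constant_spec d : exists L : R,
  [/\ connective_constant R d.+1 = expR L,
      forall n, n%:R * L <= ln (saw_count d.+1 n)%:R &
      (ln (saw_count d.+1 n)%:R / n%:R : R) @[n --> \oo] --> L].
Proof.
have c0 n : 0 < (saw_count d.+1 n)%:R :> R by rewrite ltr0n saw_count_gt0.
have [n|n m|L lb cv] := @fekete R (fun n => ln (saw_count d.+1 n)%:R).
- by rewrite ln_ge0 // ler1n saw_count_gt0.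
- rewrite -lnM ?posrE // ler_ln ?posrE ?mulr_gt0 // -natrM ler_nat.
  exact: saw_count_submultiplicative.
exists L; split=> //; apply: cvg_lim => //.
under eq_fun do rewrite powR_inv_nat ?saw_count_gt0 //.
by apply: cvg_comp cv _; exact: continuous_expR.
Qed.

Lemma bridge_count_root_cvg d :
  ((bridge_count d.+1 n)%:R `^ n%:R^-1 : R) @[n --> \oo] --> connective_constant R d.+1.
Proof.
have [L [-> lb cv]] := connective_constant_spec d.
under eq_fun do rewrite powR_inv_nat ?bridge_count_gt0 //.
suff: (ln (bridge_count d.+1 n)%:R / n%:R : R) @[n --> \oo] --> L.
  by move=> cvb; apply: cvg_comp cvb _; exact: continuous_expR.
(* Any constant above the threshold serves, since [B * sqrt n] is negligible against [n]. *)
pose B : R := pi * Num.sqrt (2 / 3) + 1.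
have B0 : 0 <= B by rewrite addr_ge0 // mulr_ge0 ?pi_ge0 ?sqrtr_ge0.
have [n0 hn0] : exists n0 : nat, forall d n, (n0 <= n)%N ->
    (saw_count d.+1 n.-1)%:R * expR (- B * Num.sqrt (n.-1)%:R) <=
      (bridge_count d.+1 n)%:R by apply: bridge_count_lower; rewrite ltrDl.
apply/cvgrPdist_le => e e0.
have e20 : 0 < e / 2 by rewrite divr_gt0.
near=> n.
have nn0 : (n0 <= n)%N by near: n; exact: nbhs_infty_ge.
have n_gt0 : (0 < n)%N by near: n; exact: nbhs_infty_gt.
have n_gt0' : 0 < n%:R :> R by rewrite ltr0n.
have b0 : 0 < (bridge_count d.+1 n)%:R :> R by rewrite ltr0n bridge_count_gt0.
have c0 m : 0 < (saw_count d.+1 m)%:R :> R by rewrite ltr0n saw_count_gt0.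
have up : `|L - ln (saw_count d.+1 n)%:R / n%:R| <= e.
  by near: n; move/cvgrPdist_le : cv; apply.
(* The allowance [e * n] is split in two: one half pays for the loss of [L] in passing to [n - 1],
   the other for [B * sqrt n]. *)
have Ln : L <= e / 2 * n%:R.
  by rewrite mulrC -ler_pdivrMr //; near: n; exact: nbhs_infty_ger.
have Bn : B * Num.sqrt n%:R <= e / 2 * n%:R.
  have -> : e / 2 * n%:R = e / 2 * Num.sqrt n%:R * Num.sqrt n%:R.
    by rewrite -[RHS]mulrA -expr2 sqr_sqrtr.
  rewrite ler_wpM2r ?sqrtr_ge0 //.
  rewrite mulrC -ler_pdivrMr // -[leLHS]ger0_norm ?divr_ge0 ?(ltW e0) //.
  rewrite -sqrtr_sqr ler_wsqrtr //; near: n; exact: nbhs_infty_ger.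
have low : n%:R * L - e * n%:R <= ln (bridge_count d.+1 n)%:R.
  have := hn0 d n nn0; rewrite -ler_ln ?posrE ?mulr_gt0 ?expR_gt0 //.
  apply: le_trans; rewrite lnM ?posrE ?expR_gt0 // expRK mulNr.
  have sn : Num.sqrt n.-1%:R <= Num.sqrt n%:R :> R.
    by rewrite ler_wsqrtr // ler_nat leq_pred.
  have Bsn := ler_wpM2l B0 sn.
  have nL : n%:R * L = n.-1%:R * L + L.
    by rewrite -{1}(prednK n_gt0) -natr1 mulrDl mul1r.
  by have := lb n.-1; lra.
have bc : ln (bridge_count d.+1 n)%:R <= ln (saw_count d.+1 n)%:R :> R.
  by rewrite ler_ln ?posrE // ler_nat bridge_count_le_saw_count.
rewrite distrC ler_distl; apply/andP; split.
  by rewrite ler_pdivlMr // mulrBl mulrC.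
apply: (@le_trans _ _ (ln (saw_count d.+1 n)%:R / n%:R)).
  by rewrite ler_wpM2r ?invr_ge0 // ltW.
by move: up; rewrite ler_distlC => /andP[].
Unshelve. all: by end_near. Qed.

End Asymptotics.

Theorem corollary2p7 (R : realType) :
  (forall B : R, B > pi * Num.sqrt (2 / 3) ->
    exists n0 : nat, forall d : nat, (2 <= d)%N -> forall n : nat, (n0 <= n)%N ->
      (bridge_count d n)%:R
        >= (saw_count d n.-1)%:R * expR (- B * Num.sqrt (n.-1)%:R) /\
      (saw_count d n.-1)%:R * expR (- B * Num.sqrt (n.-1)%:R)
        >= connective_constant R d ^+ n.-1
           * expR (- B * Num.sqrt (n.-1)%:R)) /\
  (forall d : nat, (2 <= d)%N ->
    ((fun n : nat => (bridge_count d n)%:R `^ (n%:R)^-1 : R) @ \oo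
       --> connective_constant R d) /\
    bridge_constant R d = connective_constant R d).
Proof.
split=> [B /bridge_count_lower[n0 hn0]|[//|d] _].
  exists n0 => -[//|d] _ n nn0; split; first exact: hn0.
  rewrite ler_wpM2r ?expR_ge0 //.
  (* Exponentiating [n L <= ln c_n] gives the second inequality. *)
  have [L [-> lb _]] := connective_constant_spec R d.
  rewrite -expRM_natl -[leRHS]lnK ?posrE ?ltr0n ?saw_count_gt0 //.
  by rewrite ler_expR lb.
split; first exact: bridge_count_root_cvg.
by apply: cvg_lim => //; exact: bridge_count_root_cvg.
Qed.
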